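(* Let $b_n$ ($n\ge 1$), $c_n$ ($n\ge 0$) and $\kappa$ be arbitrary nonzero constants, let $f_k$ ($k\in\mathbb{Z}$) be the moments, normalized by $f_1=\kappa$, of the Laurent biorthogonal polynomials with recurrence coefficients $b_n,c_n$, and let $\tilde\kappa=\kappa/c_0$, $\tilde b_n=b_n/(c_{n-1}c_n)$, $\tilde c_n=1/c_n$. For $s\in\mathbb{Z}$ and $n\in\mathbb{N}$, the moment determinant $\Delta^{(s)}_n=\det(f_{s-j+k})_{j,k=0,\ldots,n-1}$ satisfies $$\Delta^{(s)}_{n} = (-1)^{\frac{n(n-1)}{2}} \kappa^{n} \left( \prod_{j=1}^{n-1} b_j^{n-j} \right) \sum_{\boldsymbol{P} \in \boldsymbol{S}_{s-n,n}} w(\boldsymbol{P}) \qquad \text{if } s \ge n,$$ $$\Delta^{(s)}_{n} = (-1)^{\frac{n(n-1)}{2}} \tilde{\kappa}^{n} \left( \prod_{j=1}^{n-1} \tilde{b}_j^{n-j} \right) \sum_{\boldsymbol{P} \in \boldsymbol{S}_{|s|-n+1,n}} \tilde{w}(\boldsymbol{P}) \qquad \text{if } s \le -n+1.$$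
   Context: $\mathbb{N}=\{0,1,2,\ldots\}$; empty products and $0\times0$ determinants equal $1$. Laurent biorthogonal polynomials: $P_0(z)=1$, $P_1(z)=z-c_0$, $P_{n+1}(z)=(z-c_n)P_n(z)-b_n zP_{n-1}(z)$ for $n\ge1$. There is a linear functional $\mathcal{F}$ on Laurent polynomials in $z$, unique up to a constant factor, with $\mathcal{F}[P_n(z)z^{-k}]=h_n\delta_{n,k}$ for $0\le k\le n$ and some constants $h_n\neq0$. It is fixed by $\mathcal{F}[z]=\kappa$, and the moments are $f_k=\mathcal{F}[z^k]$, $k\in\mathbb{Z}$. A Schröder path is a lattice path in $\mathbb{Z}^2$ consisting of up steps $(1,1)$, down steps $(1,-1)$ and level steps $(2,0)$, never going beneath the $x$-axis (a path consisting of a single point is allowed). The weight $w(P)$ of a Schröder path $P$ is the product of the labels of its steps, where an up step is labelled $1$, a down step descending from the line $y=n$ (to $y=n-1$) is labelled $b_n$, and a level step on the line $y=n$ is labelled $c_n$. The weight $\tilde w(P)$ is defined in the same way with $\tilde b_n,\tilde c_n$ in place of $b_n,c_n$. For $m,n\in\mathbb{N}$, $\boldsymbol{S}_{m,n}$ is the set of $n$-tuples $\boldsymbol{P}=(P_0,\ldots,P_{n-1})$ of Schröder paths such that $P_k$ goes from $(-k,k)$ to $(2m+k,k)$ for each $k$, and any two distinct paths are non-intersecting, i.e. $P_j\cap P_k=\emptyset$ for $j\ne k$. Set $w(\boldsymbol{P})=\prod_{k=0}^{n-1}w(P_k)$ and $\tilde w(\boldsymbol{P})=\prod_{k=0}^{n-1}\tilde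 w(P_k)$. *)

(* Defs.v *)
From HB Require Import structures.
From mathcomp Require Import all_boot all_order all_algebra zify.
From mathcomp Require Import monalg.

Set Implicit Arguments.
Unset Strict Implicit.
Unset Printing Implicit Defensive.

Import GRing.Theory.
Local Open Scope ring_scope.

Section LaurentBiorthogonal.
Variable K : fieldType.
Implicit Types (b c : nat -> K) (p : {poly K}).

Fixpoint lbp b c (n : nat) : {poly K} :=
  match n with
  | 0 => 1
  | n1.+1 =>
    match n1 with
    | 0 => 'X - (c 0%N)%:P
    | n2.+1 => ('X - (c n1)%:P) * lbp b c n1 - b n1 *: ('X * lbp b c n2)
    end
  end.

(** The K-vector space of Laurent polynomials K[z, z^-1], as the free module on
    the basis z^k, k : int.  [monalg] only multiplies monomials taken in a monoid
    without nontrivial units, so products with z^k are written out below. *)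
Definition laurent := {malg K[int]}.

Definition zpow (k : int) : laurent := << k >>.

(** The Laurent polynomial p(z) z^k. *)
Definition poly_zpow p (k : int) : laurent :=
  \sum_(i < size p) p`_i *: zpow (i%:Z + k).

Definition biorthogonal b c (L : {linear laurent -> K^o}) : Prop :=
  exists2 h : nat -> K,
    forall n, h n != 0 &
    forall n k : nat, (k <= n)%N ->
      L (poly_zpow (lbp b c n) (- k%:Z)) = if n == k then h n else 0.

Definition moment (L : {linear laurent -> K^o}) (k : int) : K := L (zpow k).

(** The entry in row j and column k is f_{s-j+k}. *)
Definition moment_det (f : int -> K) (s : int) (n : nat) : K :=
  \det (\matrix_(j < n, k < n) f (s - j%:Z + k%:Z)).

End LaurentBiorthogonal.

Variant step := Up | Down | Level.

Definition step_code (e : step) : 'I_3 :=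
  match e with Up => inord 0 | Down => inord 1 | Level => inord 2 end.
Definition step_decode (i : 'I_3) : step :=
  match val i with 0 => Up | 1 => Down | _ => Level end.
Lemma step_codeK : cancel step_code step_decode.
Proof. by case; rewrite /step_decode /= inordK. Qed.
HB.instance Definition _ := Finite.copy step (can_type step_codeK).

Definition point := (int * int)%type.

Definition move (p : point) (e : step) : point :=
  match e with
  | Up => (p.1 + 1, p.2 + 1)
  | Down => (p.1 + 1, p.2 - 1)
  | Level => (p.1 + 2, p.2)
  end.

(** A path is given by its starting point [p] and its sequence of steps [t];
    [vertices p t] lists the lattice points between consecutive steps, both ends
    included. *)
Definition vertices (p : point) (t : seq step) : seq point :=
  p :: scanl move p t.

Definition schroder (p q : point) (t : seq step) : bool :=
  (foldl move p t == q) && all (fun v : point => 0 <= v.2) (vertices p t).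

Lemma size_schroder p q t : schroder p q t -> (size t)%:Z <= q.1 - p.1.
Proof.
case/andP=> /eqP<- _; elim: t p => [|e t IH] p /=; first lia.
by have := IH (move p e); case: e => /=; lia.
Qed.

Section Weight.
Variable K : fieldType.
Implicit Types b c : nat -> K.

(** The label of the step [e] leaving the point [p]; along a Schröder path p.2 is
    nonnegative, so that [`|p.2|] is just p.2 as a natural number. *)
Definition label b c (p : point) (e : step) : K :=
  match e with
  | Up => 1
  | Down => b `|p.2|%N
  | Level => c `|p.2|%N
  end.

Fixpoint weight b c (p : point) (t : seq step) : K :=
  if t is e :: t' then label b c p e * weight b c (move p e) t' else 1.

End Weight.

Definition start_point (k : nat) : point := (- k%:Z, k%:Z).
Definition end_point (m k : nat) : point := ((2 * m + k)%N%:Z, k%:Z).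

(** The n-tuples of step sequences. The bound on the lengths only serves to get a
    finite type: by [size_schroder], a path from [start_point k] to [end_point m k]
    has at most 2m+2k steps, and k < n. *)
Definition path_tuple (m n : nat) := {ffun 'I_n -> (2 * (m + n)).-bseq step}.

(** Two paths are compared through their lattice points. All the paths considered
    run through points (x, y) with x + y even, so a common point of the two
    polygonal lines gives a common lattice point. *)
Definition schroder_tuples (m n : nat) : {set path_tuple m n} :=
  [set P : path_tuple m n | [forall k : 'I_n, schroder (start_point k) (end_point m k) (P k)]
         & [forall j : 'I_n, forall k : 'I_n, (j != k) ==>
             ~~ has (mem (vertices (start_point j) (P j)))
                    (vertices (start_point k) (P k))]].

Definition tuple_weight (K : fieldType) (b c : nat -> K) (m n : nat)
    (P : path_tuple m n) : K :=
  \prod_(k < n) weight b c (start_point k) (P k).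

(* Main.v *)
From HB Require Import structures.
Require Import Defs.
From mathcomp Require Import all_boot all_order all_fingroup all_algebra zify ring.
From mathcomp Require Import monalg.

(** Write F for the functional and P_n for the polynomials.  The recurrence of the
    P_n is the first-step decomposition of Schröder paths, with an up or level step
    consuming one power of z, and biorthogonality stops it:
    F[z^(m+1) P_j P_k] is kappa b_1 ... b_k times the weighted number of paths from
    (-j,j) to (2m+k,k).  For s = m+n, reversing the rows of the moment determinant
    and changing the basis z^j to the monic P_j on both sides gives the determinant
    of these numbers.  By the Lindström-Gessel-Viennot involution, which swaps two
    paths after a common vertex, only non-intersecting tuples survive, and a planar
    argument forces them to join the k-th start to the k-th end.  The case of
    negative s follows from z -> 1/z: the moments f_(1-k) belong to the reversed
    polynomials z^n P_n(1/z) / P_n(0), whose coefficients are the b~_n and c~_n. *)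

Set Implicit Arguments.
Unset Strict Implicit.
Unset Printing Implicit Defensive.

Import Order.TTheory GRing.Theory Num.Theory.
Local Open Scope ring_scope.

(** * Vertices and crossings of paths *)

Lemma vertices_cat p t1 t2 :
  vertices p (t1 ++ t2) = vertices p t1 ++ scanl move (foldl move p t1) t2.
Proof. by rewrite /vertices scanl_cat. Qed.

Lemma last_vertices p t : last p (vertices p t) = foldl move p t.
Proof. by rewrite /=; elim: t p => //= e t IH p; apply: IH. Qed.

Lemma foldl_move_vertices p t : foldl move p t \in vertices p t.
Proof. by rewrite -last_vertices /= mem_last. Qed.

Lemma mem_vertices_lt p t v : v \in scanl move p t -> p.1 < v.1.
Proof.
elim: t p => //= e t IH p; rewrite in_cons => /predU1P[-> | /IH]; case: e => /=; lia.
Qed.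

Lemma vertices_uniq p t : uniq (vertices p t).
Proof.
elim: t p => // e t IH p; rewrite /vertices cons_uniq IH andbT.
by apply/negP => /mem_vertices_lt; rewrite ltxx.
Qed.

(** The vertex list begins with the starting point, so the index of [v] is the number of steps that
    lead to it. *)
Lemma foldl_move_take p t v :
  v \in vertices p t -> foldl move p (take (index v (vertices p t)) t) = v.
Proof.
elim: t p => [|e t IH] p; first by rewrite inE /= => /eqP.
rewrite [vertices p _]/= [index _ _]/= in_cons (eq_sym v).
by case: eqP => //= _; apply: IH.
Qed.

Lemma index_vertices_size p t v :
  v \in vertices p t -> (index v (vertices p t) <= size t)%N.
Proof. by rewrite -index_mem /= size_scanl. Qed.

Lemma index_vertices_cat p t1 t2 :
  index (foldl move p t1) (vertices p (t1 ++ t2)) = index (foldl move p t1) (vertices p t1).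
Proof. by rewrite vertices_cat index_cat foldl_move_vertices. Qed.

Lemma weight_cat (K : fieldType) (b c : nat -> K) p t1 t2 :
  weight b c p (t1 ++ t2) = weight b c p t1 * weight b c (foldl move p t1) t2.
Proof. by elim: t1 p => [|e t IH] p /=; rewrite ?mul1r // IH mulrA. Qed.

(** The upward cone with apex [p] has sides of slope 1 and -1, the extreme slopes of steps; [q] lies
    in it. *)
Definition above (q p : point) : bool :=
  (p.1 - q.1 <= q.2 - p.2) && (q.1 - p.1 <= q.2 - p.2).

Definition even_point (p : point) : Prop := exists k : int, p.1 + p.2 = 2 * k.

Lemma even_move p e : even_point p -> even_point (move p e).
Proof.
by case=> k hk; case: e => /=; [exists (k + 1)|exists k|exists (k + 1)]; move: hk => /=; lia.
Qed.

Lemma foldl_move_slope p t :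
  (foldl move p t).2 - p.2 <= (foldl move p t).1 - p.1 /\
  p.2 - (foldl move p t).2 <= (foldl move p t).1 - p.1.
Proof. by elim: t p => [|e t IH] p /=; [lia | case: (IH (move p e)); case: e => /=; lia]. Qed.

(** A step could break the cone condition only when [q] is vertically above [p]; there parity makes
    the gap at least 2, enough for any step. *)
Lemma above_move_lower p q e :
    even_point p -> even_point q -> above q p -> p != q -> p.1 <= q.1 ->
  above q (move p e).
Proof.
case: p q => [x y] [x' y'] [u /= hu] [w /= hw] /andP[/= h1 h2] /eqP hne hx.
have {}hne : ~ (x = x' /\ y = y') by case=> a d; apply: hne; rewrite a d.
by apply/andP; case: e => /=; split; lia.
Qed.

Lemma above_move_upper p q e :
    even_point p -> even_point q -> above q p -> p != q -> q.1 < p.1 ->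
  above (move q e) p.
Proof.
case: p q => [x y] [x' y'] [u /= hu] [w /= hw] /andP[/= h1 h2] /eqP hne hx.
by apply/andP; case: e => /=; split; lia.
Qed.

Lemma point_eq (p q : point) : p.1 = q.1 -> p.2 = q.2 -> p = q.
Proof. by case: p q => [x y] [x' y'] /= -> ->. Qed.

(* The path starting above cannot pass below: it leaves the cone of the other
   one only through a common vertex. *)
Lemma above_not_crossing p q t1 t2 :
    even_point p -> even_point q -> above q p ->
    ~~ has (mem (vertices p t1)) (vertices q t2) ->
  ~~ above (foldl move p t1) (foldl move q t2).
Proof.
move: {-1}(size t1 + size t2)%N (leqnn (size t1 + size t2)%N) => N.
elim: N p q t1 t2 => [|N IH] p q t1 t2 hN ep eq hqp hd; have hne : p != q.
- by apply: contraNN hd => /eqP->; apply/hasP; exists q; exact: mem_head.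
- apply: contraNN hne; move: hN hqp; rewrite leqn0 addn_eq0 !size_eq0.
  case/andP=> /eqP-> /eqP-> /= /andP[h1 h2] /andP[h3 h4].
  by apply/eqP; apply: point_eq; lia.
- by apply: contraNN hd => /eqP->; apply/hasP; exists q; exact: mem_head.
(* The path whose current point is further left advances (the lower one in a tie), which keeps the
   cone condition. *)
have [hx|hx] := lerP p.1 q.1.
  case: t1 hN hd => [|e t1] hN hd.
    (* The lower path is over; with slopes at most 1 the upper one cannot end in the downward cone
       of [p] unless [q] is [p]. *)
    apply: contraNN hne => /= /andP[h1 h2]; case/andP: hqp => h3 h4.
    have [h5 h6] := foldl_move_slope q t2.
    by apply/eqP; apply: point_eq; lia.
  apply: (IH (move p e) q t1 t2) => //; first exact: even_move.
    exact: above_move_lower.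
  apply: contraNN hd => /hasP[v hv hv'].
  by apply/hasP; exists v; rewrite //= in_cons; apply/orP; right.
case: t2 hN hd => [|e t2] hN hd.
  apply: contraNN hne => /= /andP[h1 h2]; case/andP: hqp => h3 h4.
  have [h5 h6] := foldl_move_slope p t1.
  by apply/eqP; apply: point_eq; lia.
apply: (IH p (move q e) t1 t2) => //; first by rewrite addnS in hN.
- exact: even_move.
- exact: above_move_upper.
by apply: contraNN hd => /= h; apply/orP; right.
Qed.

(** * Swapping tails *)

Local Arguments vertices : simpl never.

Section TailSwap.
Variables (n : nat) (A : 'I_n -> point).
Implicit Types (P : 'I_n -> seq step) (v : point) (s : {perm 'I_n}).

Definition visits P v : pred 'I_n := fun i => v \in vertices (A i) (P i).

(** If [v] is not on path [i], [index] returns the length of the vertex list, and cutting there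
    keeps the whole path. *)
Definition cut P v i := index v (vertices (A i) (P i)).

Definition swap_tails P v s i :=
  take (cut P v i) (P i) ++ drop (cut P v (s i)) (P (s i)).

Definition cut_point P v i := foldl move (A i) (take (cut P v i) (P i)).

Lemma vertices_cut P v i :
  vertices (A i) (P i) = vertices (A i) (take (cut P v i) (P i))
                         ++ scanl move (cut_point P v i) (drop (cut P v i) (P i)).
Proof. by rewrite -vertices_cat cat_take_drop. Qed.

Section Swap.
Variables (P : 'I_n -> seq step) (v : point) (s : {perm 'I_n}).
Hypothesis hs : forall i, s i != i -> visits P v i.
Let Q := swap_tails P v s.

Lemma swap_tails_fix i : s i = i -> Q i = P i.
Proof. by rewrite /Q /swap_tails => ->; rewrite cat_take_drop. Qed.

Lemma visits_moved i : s i != i -> visits P v (s i).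
Proof. by move=> hi; apply: hs; rewrite (inj_eq perm_inj). Qed.

Lemma cut_point_perm i : cut_point P v i = cut_point P v (s i).
Proof.
have [->//|hi] := eqVneq (s i) i.
by rewrite /cut_point (foldl_move_take (hs hi)) (foldl_move_take (visits_moved hi)).
Qed.

Lemma vertices_swap_tails i :
  vertices (A i) (Q i) =
  vertices (A i) (take (cut P v i) (P i))
  ++ scanl move (cut_point P v (s i)) (drop (cut P v (s i)) (P (s i))).
Proof. by rewrite vertices_cat -cut_point_perm. Qed.

Lemma foldl_swap_tails i : foldl move (A i) (Q i) = foldl move (A (s i)) (P (s i)).
Proof.
by rewrite foldl_cat -/(cut_point P v i) cut_point_perm /cut_point -foldl_cat cat_take_drop.
Qed.

Lemma visits_swap_tails : visits Q v =1 visits P v.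
Proof.
move=> i; have [hi|hi] := eqVneq (s i) i; first by rewrite /visits swap_tails_fix.
rewrite /visits vertices_swap_tails mem_cat -[X in X \in vertices _ _](foldl_move_take (hs hi)).
by rewrite foldl_move_vertices; apply/esym; apply: hs.
Qed.

(** The initial part up to [v] is kept, and [v] still occurs first at its end. *)
Lemma cut_swap_tails i : cut Q v i = cut P v i.
Proof.
have [hi|hi] := eqVneq (s i) i; first by rewrite /cut swap_tails_fix.
have hv := foldl_move_take (hs hi); rewrite -/(cut P v i) in hv.
have E t : index v (vertices (A i) (take (cut P v i) (P i) ++ t))
         = index v (vertices (A i) (take (cut P v i) (P i))).
  by have := index_vertices_cat (A i) (take (cut P v i) (P i)) t; rewrite hv.
by rewrite {1}/cut E -(E (drop (cut P v i) (P i))) cat_take_drop.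
Qed.

Lemma swap_tailsK : swap_tails Q v s^-1 =1 P.
Proof.
have hQ i : s i != i -> (take (cut P v i) (Q i) = take (cut P v i) (P i)) *
                        (drop (cut P v i) (Q i) = drop (cut P v (s i)) (P (s i))).
  move=> hi; have hsz : size (take (cut P v i) (P i)) = cut P v i.
    by rewrite size_takel // index_vertices_size //; apply: hs.
  by rewrite /Q /swap_tails -{1 4}hsz take_size_cat // drop_size_cat.
move=> i; have [hi|hi] := eqVneq (s^-1 i)%g i.
  rewrite /swap_tails hi !cat_take_drop swap_tails_fix //.
  by rewrite -{1}hi permKV.
have hi1 : s i != i by apply: contraNneq hi => h; rewrite -{1}h permK.
have hi2 : s (s^-1 i)%g != (s^-1 i)%g by rewrite permKV eq_sym.
by rewrite /swap_tails !cut_swap_tails !hQ // permKV cat_take_drop.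
Qed.

(** Tails are only redistributed among the paths, so reindexing by [s^-1] restores the total. This
    makes the set of meeting points invariant. *)
Lemma count_swap_tails u :
  (\sum_i count_mem u (vertices (A i) (Q i)) =
   \sum_i count_mem u (vertices (A i) (P i)))%N.
Proof.
transitivity (\sum_i (count_mem u (vertices (A i) (take (cut P v i) (P i)))
   + count_mem u (scanl move (cut_point P v (s i)) (drop (cut P v (s i)) (P (s i))))))%N.
  by apply: eq_bigr => i _; rewrite vertices_swap_tails count_cat.
rewrite big_split /= [X in (_ + X)%N](reindex_perm s^-1) /= -big_split.
apply: eq_bigr => i _; rewrite permKV.
by have := congr1 (count_mem u) (vertices_cut P v i); rewrite count_cat => /esym.
Qed.

Lemma weight_swap_tails (K : fieldType) (b c : nat -> K) :
  \prod_i weight b c (A i) (Q i) = \prod_i weight b c (A i) (P i).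
Proof.
transitivity (\prod_i (weight b c (A i) (take (cut P v i) (P i))
   * weight b c (cut_point P v (s i)) (drop (cut P v (s i)) (P (s i))))).
  by apply: eq_bigr => i _; rewrite weight_cat -/(cut_point P v i) cut_point_perm.
rewrite big_split /= [X in _ * X](reindex_perm s^-1) /= -big_split.
apply: eq_bigr => i _; rewrite permKV.
by have := weight_cat b c (A i) (take (cut P v i) (P i)) (drop (cut P v i) (P i));
   rewrite cat_take_drop => /esym.
Qed.

Lemma all_swap_tails (p : pred point) :
  (forall i, all p (vertices (A i) (P i))) -> forall i, all p (vertices (A i) (Q i)).
Proof.
move=> h i; rewrite vertices_swap_tails all_cat.
have := h i; rewrite (vertices_cut P v i) all_cat => /andP[-> _].
by have := h (s i); rewrite (vertices_cut P v (s i)) all_cat => /andP[].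
Qed.

End Swap.

(** * Canonical choice of a crossing *)

Definition meets P v := (1 < #|visits P v|)%N.

(** Every step goes to the right, so a path visits a point at most once. *)
Lemma card_visits P v : #|visits P v| = (\sum_i count_mem v (vertices (A i) (P i)))%N.
Proof.
rewrite -sum1_card big_mkcond; apply: eq_bigr => i _.
by rewrite count_uniq_mem ?vertices_uniq // unfold_in /visits; case: (v \in _).
Qed.

(** [choose] needs a witness: any meeting point serves, with [(0, 0)] as default when there is
    none. *)
Definition crossing_seed P : point :=
  head (0, 0) [seq v <- flatten [seq vertices (A i) (P i) | i : 'I_n] | meets P v].

(* A choice depending only on the predicate [meets P], hence invariant under
   swapping tails. *)
Definition crossing_point P : point := choose (meets P) (crossing_seed P).

(** The pair depends only on which paths visit [v], so it is found again after the swap. *)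
Definition crossing_pair P v : option ('I_n * 'I_n) :=
  [pick jk : 'I_n * 'I_n | [&& jk.1 != jk.2, visits P v jk.1 & visits P v jk.2]].

Definition crossing_perm P v : {perm 'I_n} :=
  if crossing_pair P v is Some jk then tperm jk.1 jk.2 else 1%g.

Definition uncross P := swap_tails P (crossing_point P) (crossing_perm P (crossing_point P)).

Lemma crossing_perm_moved P v i : crossing_perm P v i != i -> visits P v i.
Proof.
rewrite /crossing_perm /crossing_pair; case: pickP => [[j k] /= /and3P[_ hj hk]|_].
  by case: tpermP => [->|->|] //; rewrite eqxx.
by rewrite perm1 eqxx.
Qed.

Lemma crossing_permV P v : (crossing_perm P v)^-1%g = crossing_perm P v.
Proof. by rewrite /crossing_perm; case: crossing_pair => [jk|]; rewrite ?tpermV ?invg1. Qed.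

Lemma meets_crossing_seed P v : meets P v -> meets P (crossing_seed P).
Proof.
move=> hv; rewrite /crossing_seed.
set r := [seq _ <- _ | _]; have hr : v \in r.
  rewrite mem_filter hv; apply/flattenP.
  have [j [k [hj _ _]]] := card_gt1P hv.
  by exists (vertices (A j) (P j)) => //; apply: image_f.
have : all (meets P) r by apply: filter_all.
by case: r hr => //= a r _ /andP[].
Qed.

Lemma crossing_perm_tperm P v : meets P v ->
  exists j k, j != k /\ crossing_perm P v = tperm j k.
Proof.
move=> hv; rewrite /crossing_perm /crossing_pair.
case: pickP => [[j k] /= /and3P[hjk _ _]|h]; first by exists j, k.
have [j [k [hj hk hjk]]] := card_gt1P hv.
by have := h (j, k); rewrite /= hjk (hj : visits P v j) (hk : visits P v k).
Qed.

Lemma meets_uncross P : meets (uncross P) =1 meets P.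
Proof.
move=> v; rewrite /meets !card_visits count_swap_tails //.
exact: crossing_perm_moved.
Qed.

Lemma uncrossK P v : meets P v -> uncross (uncross P) =1 P.
Proof.
move=> hv; have hm := @crossing_perm_moved P (crossing_point P).
have hc : crossing_point (uncross P) = crossing_point P.
  (* The two seeds may differ, but [choose] returns the same point for any valid seed. *)
  rewrite {1}/crossing_point (eq_choose (meets_uncross P)); apply: choose_id.
    by rewrite -meets_uncross; apply: (@meets_crossing_seed _ v); rewrite meets_uncross.
  exact: meets_crossing_seed hv.
have hs : crossing_perm (uncross P) (crossing_point P) = crossing_perm P (crossing_point P).
  rewrite /crossing_perm; congr (if _ is Some jk then _ else _).
  by apply: eq_pick => jk; rewrite /= !visits_swap_tails.
rewrite {1}/uncross hc hs -{1}[crossing_perm P _]crossing_permV.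
exact: swap_tailsK.
Qed.
End TailSwap.

(** * The Lindström-Gessel-Viennot determinant *)

(** Terms cancel in pairs. Fixed points need a hypothesis of their own, since [f x = - f x] does not
    give zero in characteristic 2. *)
Lemma sum_anti_involution (V : zmodType) (T : finType) (D : pred T) (phi : T -> T) (f : T -> V) :
    (forall x, D x -> D (phi x)) -> (forall x, D x -> phi (phi x) = x) ->
    (forall x, D x -> f (phi x) = - f x) -> (forall x, D x -> phi x = x -> f x = 0) ->
  \sum_(x | D x) f x = 0.
Proof.
(* An injective rank separates the two members of each pair; equal ranks mean a fixed point. *)
move=> hD hK hf h0; have [r hr] : exists r : T -> nat, injective r.
  by exists (fun x => nat_of_ord (enum_rank x)) => x y /val_inj/enum_rank_inj.
rewrite (bigID (fun x => r x < r (phi x))%N) /=.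
rewrite [X in _ + X](bigID (fun x => r (phi x) < r x)%N) /= addrA.
rewrite [X in _ + X]big1 ?addr0 => [|x /andP[/andP[Dx h1] h2]]; last first.
  by apply: h0 => //; apply: hr; lia.
rewrite [X in _ + X](_ : _ = - \sum_(x | D x && (r x < r (phi x))%N) f x) ?subrr //.
rewrite -sumrN (reindex_onto phi phi) /= => [|x /andP[/andP[Dx _] _]]; last exact: hK.
apply: eq_big => [x|x /andP[/andP[/andP[Dx _] _] /eqP hx]]; last first.
  by apply: hf; rewrite -hx; apply: hD.
apply/idP/idP => [/andP[/andP[/andP[Dx _] h1] /eqP hx]|/andP[Dx h]].
  by rewrite hx in h1; rewrite -hx hD //= hx.
by rewrite hD // hK // eqxx h -leqNgt ltnW.
Qed.

(** The sum over permutations stays inside as the determinant of a 0-1 matrix, so that exchanging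
    two tails will exchange two rows. *)
Lemma det_sum_distr (R : comNzRingType) (n : nat) (T : finType)
    (w : 'I_n -> T -> R) (e : 'I_n -> 'I_n -> T -> bool) :
  \det (\matrix_(i, j) \sum_(t | e i j t) w i t) =
  \sum_(P : {ffun 'I_n -> T})
     \prod_i w i (P i) * \det (\matrix_(i, j) (e i j (P i))%:R).
Proof.
rewrite /determinant.
transitivity (\sum_(s : 'S_n) \sum_(P : {ffun 'I_n -> T})
   (-1) ^+ s * \prod_i (w i (P i) * (e i (s i) (P i))%:R)).
  apply: eq_bigr => s _; rewrite -big_distrr; congr (_ * _).
  rewrite -(bigA_distr_bigA (fun i t => w i t * (e i (s i) t)%:R)).
  apply: eq_bigr => i _; rewrite mxE big_mkcond; apply: eq_bigr => t _.
  by case: ifP; rewrite ?mulr1 ?mulr0.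
rewrite exchange_big; apply: eq_bigr => P _; rewrite big_distrr; apply: eq_bigr => s _.
rewrite big_split /= mulrCA; congr (_ * (_ * _)).
by apply: eq_bigr => i _; rewrite mxE.
Qed.

(** An increasing permutation satisfies [i <= s i], and so does its inverse. *)
Lemma perm_homo_id n (s : 'S_n) : (forall i j : 'I_n, i < j -> s i < s j)%N -> s = 1%g.
Proof.
have ge_id (u : 'S_n) : (forall i j : 'I_n, i < j -> u i < u j)%N -> forall i : 'I_n, (i <= u i)%N.
  move=> hu [i hi]; elim: i hi => // i IH hi /=.
  exact: leq_ltn_trans (IH (ltnW hi)) (hu (Ordinal (ltnW hi)) (Ordinal hi) (ltnSn i)).
move=> hs; apply/permP => i; rewrite perm1; apply: val_inj; apply/eqP.
rewrite eqn_leq ge_id // andbT.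
have h := @ge_id s^-1%g _ (s i); rewrite permK in h; apply: h => j k hjk.
rewrite ltnNge leq_eqVlt; apply/negP => /orP[/eqP/val_inj/perm_inj hk|/hs].
  by rewrite hk ltnn in hjk.
by rewrite !permKV; lia.
Qed.

Definition nonintersecting n (A : 'I_n -> point) (P : 'I_n -> seq step) : bool :=
  [forall j : 'I_n, forall k : 'I_n, (j != k) ==>
     ~~ has (mem (vertices (A j) (P j))) (vertices (A k) (P k))].

Lemma intersecting_meets n (A : 'I_n -> point) P : ~~ nonintersecting A P -> exists v, meets A P v.
Proof.
case/forallPn => j /forallPn[k]; rewrite negb_imply negbK => /andP[hjk /hasP[v hk hj]].
by exists v; apply/card_gt1P; exists j, k.
Qed.

Lemma meets_intersecting n (A : 'I_n -> point) P v : meets A P v -> ~~ nonintersecting A P.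
Proof.
move/card_gt1P=> [j [k [hj hk hjk]]]; apply/forallPn; exists j; apply/forallPn; exists k.
by rewrite negb_imply hjk negbK; apply/hasP; exists v.
Qed.

(** Families of paths are known equal only pointwise, and iterating [uncross] requires all its
    choices to respect that. *)
Lemma eq_uncross n (A : 'I_n -> point) P Q : P =1 Q -> uncross A P =1 uncross A Q.
Proof.
move=> h i; have hv v k : visits A P v k = visits A Q v k by rewrite /visits h.
have hm : meets A P =1 meets A Q by move=> v; rewrite /meets (eq_card (hv v)).
have hc : crossing_point A P = crossing_point A Q.
  rewrite /crossing_point (eq_choose hm); congr choose.
  rewrite /crossing_seed (eq_filter hm); congr (head _ [seq _ <- flatten _ | _]).
  by apply: eq_image => // k; rewrite h.
have hp v : crossing_perm A P v = crossing_perm A Q v.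
  rewrite /crossing_perm; congr (if _ is Some jk then _ else _).
  by apply: eq_pick => jk; rewrite /= !hv.
by rewrite /uncross hc hp /swap_tails /cut !h.
Qed.

Section GesselViennot.
Variables (K : fieldType) (b c : nat -> K) (n N : nat) (A B : 'I_n -> point).
Hypothesis hN : forall i j, (B j).1 - (A i).1 <= N%:Z.
Implicit Types P : {ffun 'I_n -> N.-bseq step}.

Let paths P : 'I_n -> seq step := fun i => P i.
Let ends P : 'M[K]_n := \matrix_(i, j) (schroder (A i) (B j) (P i))%:R.
Let proper P := [forall i, exists j, schroder (A i) (B j) (P i)].

(** On proper tuples the bound [hN] makes the swapped paths short enough, so the default value of
    [insub_bseq] does not occur. *)
Let phi P : {ffun 'I_n -> N.-bseq step} := [ffun i => insub_bseq N (uncross A (paths P) i)].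

Let uncross_schroder P i j v : meets A (paths P) v -> proper P ->
  schroder (A i) (B j) (uncross A (paths P) i) =
  let k := crossing_perm A (paths P) (crossing_point A (paths P)) i in
  schroder (A k) (B j) (P k).
Proof.
move=> hv /forallP hP /=; have hm := @crossing_perm_moved _ A (paths P) (crossing_point A (paths P)).
have hnn k : all (fun v : point => 0 <= v.2) (vertices (A k) (paths P k)).
  by have /existsP[l /andP[]] := hP k.
by rewrite /schroder foldl_swap_tails // all_swap_tails // hnn.
Qed.

Let phiE P v i : meets A (paths P) v -> proper P -> paths (phi P) i = uncross A (paths P) i.
Proof.
move=> hv hP; rewrite /paths ffunE; apply: insubdK; rewrite unfold_in.
have /forallP/(_ (crossing_perm A (paths P) (crossing_point A (paths P)) i)) := hP.
case/existsP => j; have /= <- := uncross_schroder i j hv hP; move/size_schroder.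
by have := hN i j; lia.
Qed.

(** Uncrossing keeps the weight and exchanges two rows of [ends P], hence reverses the sign of the
    term. *)
Lemma sum_intersecting_eq0 :
  \sum_(P : {ffun 'I_n -> N.-bseq step} | ~~ nonintersecting A (paths P))
     \prod_i weight b c (A i) (P i) * \det (ends P) = 0.
Proof.
rewrite (bigID proper) /= [X in _ + X]big1 ?addr0 => [|P /andP[_ /forallPn[i]]]; last first.
  (* A path reaching no end gives [ends P] a zero row. *)
  rewrite negb_exists => /forallP hi; rewrite (expand_det_row _ i) [X in _ * X]big1 ?mulr0 // => j _.
  by rewrite mxE (negbTE (hi j)) mul0r.
have endsE P v : meets A (paths P) v -> proper P -> ends (phi P) =
    row_perm (crossing_perm A (paths P) (crossing_point A (paths P))) (ends P).
  move=> hv hP; apply/matrixP=> i j; rewrite !mxE; congr (nat_of_bool _)%:R.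
  by have /= <- := uncross_schroder i j hv hP; rewrite -(phiE i hv hP).
have permE P v : meets A (paths P) v -> exists j k, j != k /\
    crossing_perm A (paths P) (crossing_point A (paths P)) = tperm j k.
  by move=> hv; apply/crossing_perm_tperm/chooseP/(meets_crossing_seed hv).
have phi_meets P v : meets A (paths P) v -> proper P -> meets A (paths (phi P)) v.
  move=> hv hP; have := hv; rewrite -meets_uncross; apply: etrans.
  congr (1 < _)%N; apply: eq_card => i; rewrite !unfold_in /visits.
  by rewrite (phiE i hv hP).
have phi_proper P v : meets A (paths P) v -> proper P -> proper (phi P).
  move=> hv hP; apply/forallP => i.
  have /forallP/(_ (crossing_perm A (paths P) (crossing_point A (paths P)) i)) := hP.
  case/existsP => j hj; apply/existsP; exists j.
  rewrite -[X in schroder _ _ X]/(paths (phi P) i) (phiE i hv hP).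
  by rewrite (uncross_schroder i j hv hP).
apply: (@sum_anti_involution _ _ _ phi) => P /andP[/intersecting_meets[v hv] hP].
- by rewrite (phi_proper _ _ hv hP) (meets_intersecting (phi_meets _ _ hv hP)).
- apply/ffunP=> i; apply: val_inj; rewrite -[LHS]/(paths (phi (phi P)) i) -[RHS]/(paths P i).
  rewrite (phiE i (phi_meets _ _ hv hP) (phi_proper _ _ hv hP)).
  by rewrite (eq_uncross A (fun k => phiE k hv hP)) (uncrossK hv).
- rewrite (endsE P v) // row_permE det_mulmx det_perm.
  have [j [k [hjk ->]]] := permE P v hv; rewrite odd_tperm hjk expr1 mulN1r mulrN.
  congr (- (_ * _)).
  rewrite -(weight_swap_tails (@crossing_perm_moved _ A (paths P) (crossing_point A (paths P)))).
  by apply: eq_bigr => i _; rewrite -/(paths (phi P) i) (phiE _ hv hP).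
(* A tuple fixed by [phi] gives [ends P] two equal rows. *)
move=> hphi; have [j [k [hjk hs]]] := permE P v hv.
rewrite (@determinant_alternate _ _ _ j k) ?mulr0 // => l.
by rewrite -{1}hphi (endsE P v) // hs mxE tpermL.
Qed.

Hypothesis evenA : forall i, even_point (A i).
Hypothesis aboveA : forall i j : 'I_n, (i < j)%N -> above (A j) (A i).
Hypothesis aboveB : forall i j : 'I_n, (i <= j)%N -> above (B j) (B i).

Lemma det_nonintersecting :
  \det (\matrix_(i, j) \sum_(t : N.-bseq step | schroder (A i) (B j) t)
          weight b c (A i) t) =
  \sum_(P : {ffun 'I_n -> N.-bseq step} |
          [forall i, schroder (A i) (B i) (P i)] && nonintersecting A (paths P))
     \prod_i weight b c (A i) (P i).
Proof.
rewrite (det_sum_distr (fun i (t : N.-bseq step) => weight b c (A i) t)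
  (fun i j (t : N.-bseq step) => schroder (A i) (B j) t)).
rewrite (bigID (fun P => nonintersecting A (paths P))) /= sum_intersecting_eq0 addr0.
rewrite [RHS]big_mkcond [LHS]big_mkcond; apply: eq_bigr => P _.
rewrite andbC; case: ifP => //= hP.
have prodE (s : 'S_n) :
    \prod_i ((\matrix_(i, j) (schroder (A i) (B j) (P i))%:R) i (s i) : K) =
    ([forall i, schroder (A i) (B (s i)) (P i)])%:R.
  have [/forallP hs|/forallPn[i hi]] := boolP [forall i, schroder (A i) (B (s i)) (P i)].
    by rewrite big1 // => i _; rewrite mxE hs.
  by rewrite (bigD1 i) //= mxE (negbTE hi) mul0r.
rewrite /determinant (bigD1 1%g) //= odd_perm1 expr0 mul1r prodE [X in _ + X]big1 => [|s hs].
  rewrite addr0 (_ : [forall i, _] = [forall i, schroder (A i) (B i) (P i)]); last first.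
    by apply: eq_forallb => i; rewrite perm1.
  by case: ifP; rewrite ?mulr1 ?mulr0.
rewrite prodE; have [/forallP hall|] := boolP [forall i, schroder (A i) (B (s i)) (P i)];
  last by rewrite mulr0.
(* Otherwise path [j], which starts above path [i], would end below it without meeting it; so [s] is
   increasing. *)
case/eqP: hs; apply: perm_homo_id => i j hij; rewrite ltnNge; apply/negP => /aboveB.
have /andP[/eqP <- _] := hall i; have /andP[/eqP <- _] := hall j.
apply/negP/above_not_crossing; rewrite ?aboveA //.
have /forallP/(_ i)/forallP/(_ j)/implyP := hP; apply.
by apply: contraTneq hij => ->; rewrite ltnn.
Qed.
End GesselViennot.

(** * Weighted path sums and moment functionals *)

Section PathSum.
Variables (K : fieldType) (b c : nat -> K).
Implicit Types p q : point.

Lemma sum_bseqS (V : nmodType) (T : finType) (N : nat) (F : seq T -> V) :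
  \sum_(t : N.+1.-bseq T) F t = F [::] + \sum_(e : T) \sum_(t : N.-bseq T) F (e :: t).
Proof.
pose vals n := [seq val t | t <- index_enum (n.-bseq T)].
have big_vals n (G : seq T -> V) : \sum_(t : n.-bseq T) G t = \sum_(t <- vals n) G t.
  by rewrite big_map.
have mem_vals n t : (t \in vals n) = (size t <= n)%N.
  apply/mapP/idP => [[u _ ->]|ht]; first exact: size_bseq.
  by exists (Bseq ht); rewrite ?mem_index_enum.
have uniq_vals n : uniq (vals n) by rewrite map_inj_uniq ?index_enum_uniq //; apply: val_inj.
rewrite big_vals (perm_big ([::] :: [seq e :: t | e <- index_enum T, t <- vals N])).
  rewrite big_cons big_allpairs_dep; congr (_ + _).
  by apply: eq_bigr => e _; rewrite -big_vals.
apply: uniq_perm => //=.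
  apply/andP; split; first by apply/allpairsP => -[[e t] []].
  by apply: allpairs_uniq; rewrite ?index_enum_uniq // => -[e t] [e' t'] _ _ /= [-> ->].
move=> [|e t]; rewrite mem_vals inE //=; apply/esym.
apply/allpairsP/idP => [[[e' t'] /= [_ h [_ ->]]]|h].
  by rewrite mem_vals in h.
by exists (e, t); rewrite mem_index_enum mem_vals.
Qed.

Lemma sum_step (V : nmodType) (F : step -> V) :
  \sum_(e : step) F e = F Up + F Level + F Down.
Proof.
rewrite (perm_big [:: Up; Level; Down]); first by rewrite !big_cons big_nil /= addr0 addrA.
apply: uniq_perm; rewrite ?index_enum_uniq //=.
  by rewrite !inE; do !case: eqP.
by move=> e; rewrite mem_index_enum !inE; case: e; rewrite eqxx ?orbT.
Qed.

(** [N] bounds the number of steps; by [size_schroder] the sum runs over all paths once [N] reaches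
    the horizontal distance. *)
Definition path_sum (N : nat) (p q : point) : K :=
  \sum_(t : N.-bseq step | schroder p q t) weight b c p t.

Lemma schroder_nil p q : schroder p q [::] = (p == q) && (0 <= p.2).
Proof. by rewrite /schroder /= andbT. Qed.

Lemma schroder_cons p q e t :
  schroder p q (e :: t) = (0 <= p.2) && schroder (move p e) q t.
Proof. by rewrite /schroder /= andbCA. Qed.

Lemma path_sum0 p q : path_sum 0 p q = ((p == q) && (0 <= p.2))%:R.
Proof.
rewrite /path_sum big_mkcond /= (eq_bigr (fun _ => ((p == q) && (0 <= p.2))%:R)).
  by rewrite sumr_const -[#|_|]/#|{: 0.-bseq step}| card_bseq big_ord1.
by move=> [[|//] h] _; rewrite /= schroder_nil; case: ifP.
Qed.

Lemma path_sumS N p q : 0 <= p.2 ->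
  path_sum N.+1 p q = (p == q)%:R + \sum_e label b c p e * path_sum N (move p e) q.
Proof.
move=> hp; rewrite /path_sum big_mkcond /=.
rewrite (sum_bseqS N (fun t => if schroder p q t then weight b c p t else 0)).
rewrite schroder_nil hp andbT; congr (_ + _); first by case: eqP.
apply: eq_bigr => e _; rewrite big_distrr [RHS]big_mkcond; apply: eq_bigr => t _.
by rewrite schroder_cons hp /=; case: ifP.
Qed.

Lemma path_sum_neg N p q : p.2 < 0 -> path_sum N p q = 0.
Proof.
move=> hp; rewrite /path_sum big_pred0 // => t.
by rewrite /schroder /= (lt_geF hp) andbF.
Qed.

(** Up and level steps raise x + y by 2, and down steps keep it. *)
Lemma schroder_slope p q t : schroder p q t -> p.1 + p.2 <= q.1 + q.2.
Proof. by case/andP=> /eqP<- _; case: (foldl_move_slope p t); lia. Qed.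

Lemma path_sum_back N p q : q.1 + q.2 < p.1 + p.2 -> path_sum N p q = 0.
Proof.
move=> hpq; rewrite /path_sum big_pred0 // => t; apply/negP => /schroder_slope.
by rewrite leNgt hpq.
Qed.
End PathSum.

Section Functional.
Variables (K : fieldType).
Implicit Types (f : int -> K) (p q : {poly K}).

(* The value at z^a p(z) of the functional on Laurent polynomials with moments f. *)
Definition ev f (a : int) p : K := \sum_(i < size p) p`_i * f (i%:Z + a).

Lemma evE f a p N : (size p <= N)%N -> ev f a p = \sum_(i < N) p`_i * f (i%:Z + a).
Proof.
move=> h; rewrite /ev (big_ord_widen _ (fun i : nat => p`_i * f (i%:Z + a)) h) big_mkcond.
by apply: eq_bigr => i _; case: ltnP => // hi; rewrite nth_default ?mul0r.
Qed.

Lemma ev_is_linear f a : scalar (ev f a).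
Proof.
move=> x p q; set N := maxn (size p) (size q).
rewrite !(@evE _ _ _ N) ?leq_maxl ?leq_maxr //; last first.
  rewrite (leq_trans (size_polyD _ _)) // geq_max leq_maxr.
  by rewrite (leq_trans (size_scale_leq _ _)) ?leq_maxl.
rewrite big_distrr -big_split; apply: eq_bigr => i _ /=.
by rewrite coefD coefZ mulrDl mulrA.
Qed.

HB.instance Definition _ f a :=
  GRing.isLinear.Build K {poly K} K _ (ev f a) (ev_is_linear f a).

Lemma ev1 f a : ev f a 1 = f a.
Proof. by rewrite (@evE _ _ _ 1) ?size_poly1 // big_ord1 coef1 mul1r add0r. Qed.

Lemma evXM f a p : ev f a ('X * p) = ev f (a + 1) p.
Proof.
rewrite (@evE _ _ _ (size p).+1); last by rewrite (leq_trans (size_polyMleq _ _)) // size_polyX.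
rewrite big_ord_recl coefXM mul0r add0r; apply: eq_bigr => i _.
by rewrite coefXM /=; congr (_ * f _); rewrite /bump /=; lia.
Qed.

Lemma evM f a p q N : (size q <= N)%N ->
  ev f a (p * q) = \sum_(i < N) q`_i * ev f (a + i%:Z) p.
Proof.
move=> hq; have evXn i : forall d, ev f d ('X^i * p) = ev f (d + i%:Z) p.
  elim: i => [|i IH] d; first by rewrite mul1r addr0.
  by rewrite exprS -mulrA evXM IH; congr ev; lia.
have hq' : q = \sum_(i < N) q`_i *: 'X^i.
  rewrite -[LHS]coefK poly_def (big_ord_widen _ (fun i : nat => q`_i *: 'X^i) hq) big_mkcond.
  by apply: eq_bigr => i _; case: ltnP => // hi; rewrite nth_default ?scale0r.
rewrite [in LHS]hq' mulr_sumr linear_sum; apply: eq_bigr => i _.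
by rewrite -scalerAr linearZ /= [p * _]mulrC evXn.
Qed.
End Functional.

(** * Orthogonality and path sums *)

Section Orthogonality.
Variables (K : fieldType) (b c : nat -> K) (f : int -> K) (kappa : K).
Implicit Types (a : int) (q : {poly K}).
Let P := lbp b c.

Lemma lbpS n : 'X * lbp b c n = lbp b c n.+1 + c n *: lbp b c n
  + (if n is m.+1 then b n *: ('X * lbp b c m) else 0).
Proof.
case: n => [|n]; rewrite -mul_polyC; first by rewrite /= !mulr1 addr0 subrK.
by rewrite -/(lbp b c n.+2) [lbp b c n.+2]/= -/(lbp b c n.+1) mulrBl addrAC addrNK subrK.
Qed.

Local Arguments lbp : simpl never.

Lemma size_lbp_lead n : (size (lbp b c n) <= n.+1)%N /\ (lbp b c n)`_n = 1.
Proof.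
(* The recurrence has two terms, so two consecutive degrees are carried through the induction. *)
suff: ((size (lbp b c n) <= n.+1)%N /\ (lbp b c n)`_n = 1) /\
  ((size (lbp b c n.+1) <= n.+2)%N /\ (lbp b c n.+1)`_n.+1 = 1) by case.
elim: n => [|n [[s0 l0] [s1 l1]]].
  by rewrite [lbp b c 0]/lbp [lbp b c 1]/lbp size_poly1 size_XsubC coef1 coefB coefX coefC subr0.
split => //; have -> : lbp b c n.+2 = 'X * lbp b c n.+1 - c n.+1 *: lbp b c n.+1
    - b n.+1 *: ('X * lbp b c n) by rewrite (lbpS n.+1) addrAC !addrK.
split.
  apply/leq_sizeP => i hi; rewrite !coefB !coefZ !coefXM.
  case: i hi => // i; rewrite ltnS => hi; rewrite /= !nth_default ?(mulr0, subr0) //.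
  - exact: leq_trans s0 (ltnW hi).
  - exact: leq_trans s1 (leqW hi).
  exact: leq_trans s1 hi.
rewrite !coefB !coefZ !coefXM /= l1.
by rewrite !nth_default ?(mulr0, subr0).
Qed.

Definition lbp_orthogonal : Prop :=
  forall n k : nat, (k < n)%N -> ev f (- k%:Z) (lbp b c n) = 0.

Hypothesis orth : lbp_orthogonal.
Hypothesis f1 : f 1 = kappa.

(** All exponents in z^a q lie between 1 - n and 0, where [P n] is orthogonal. *)
Lemma lbp_orthogonal_mul n a q M : (size q <= M)%N -> - n%:Z < a -> a + M%:Z <= 1 ->
  ev f a (P n * q) = 0.
Proof.
move=> hq h1 h2; rewrite (evM _ _ _ hq) big1 // => i _.
rewrite (_ : a + i%:Z = - (absz (a + i%:Z))%:Z); last by have := ltn_ord i; lia.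
by rewrite orth ?mulr0 //; have := ltn_ord i; lia.
Qed.

(** The three terms correspond to an up, level or down step from height [j]; the first two use one
    power of z. *)
Lemma ev_lbp_rec a j q : ev f (a + 1) (P j * q) =
  ev f a (P j.+1 * q) + c j * ev f a (P j * q)
  + (if j is i.+1 then b j * ev f (a + 1) (P i * q) else 0).
Proof.
rewrite -evXM mulrA lbpS !mulrDl !linearD -scalerAl linearZ; congr (_ + _).
case: j => [|j]; first by rewrite mul0r linear0.
by rewrite -scalerAl linearZ -[in LHS]mulrA /= evXM.
Qed.

Lemma size_lbp n : (size (P n) <= n.+1)%N.
Proof. by case: (size_lbp_lead n). Qed.

Lemma lbp_coef0S n : (P n.+1)`_0 = - c n * (P n)`_0.
Proof.
have := congr1 (fun p : {poly K} => p`_0) (lbpS n); rewrite !coefD coefXM coefZ.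
case: n => [|n]; rewrite ?coefZ ?coefXM ?coef0 ?mulr0 addr0 mulNr => h;
  by apply/eqP; rewrite -addr_eq0 -h.
Qed.

(** Orthogonality leaves two terms of the recurrence for z P_(n+1) paired with z^-(n+1); they link
    consecutive norms h_n = F[z^-n P_n]. *)
Lemma lbp_normS n : c n.+1 * ev f (- n.+1%:Z) (P n.+1) = - b n.+1 * ev f (- n%:Z) (P n).
Proof.
have := ev_lbp_rec (- n.+1%:Z) n.+1 1; rewrite !mulr1 /= -/(P n.+2).
rewrite (_ : - n.+1%:Z + 1 = - n%:Z); last by lia.
rewrite (orth (ltnSn n)) (orth (ltnSn n.+1)) add0r => /eqP; rewrite eq_sym addr_eq0 => /eqP->.
by rewrite mulNr.
Qed.

Lemma ev_lbp_sq_shift k : ev f (- k%:Z) (P k * P k) = (P k)`_0 * ev f (- k%:Z) (P k).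
Proof.
rewrite (evM _ _ _ (size_lbp k)) big_ord_recl addr0 big1 ?addr0 // => i _.
rewrite lift0 (_ : - k%:Z + _ = - (k - i.+1)%N%:Z); last by have := ltn_ord i; lia.
by rewrite orth ?mulr0 //; have := ltn_ord i; lia.
Qed.

(** The value is c_k P_k(0) h_k, and the recursions for P_k(0) and h_k multiply it by b_(k+1) when k
    grows by one. *)
Lemma ev_lbp_sq k : ev f (1 - k%:Z) (P k * P k) = kappa * \prod_(1 <= i < k.+1) b i.
Proof.
have eqn j : ev f (1 - j%:Z) (P j * P j) = c j * (P j)`_0 * ev f (- j%:Z) (P j).
  rewrite addrC ev_lbp_rec (@lbp_orthogonal_mul _ _ _ j.+1) ?size_lbp //; try lia.
  rewrite add0r ev_lbp_sq_shift mulrA; case: j => [|j]; first by rewrite addr0.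
  rewrite [P j * _]mulrC (@lbp_orthogonal_mul _ _ _ j.+1) ?size_lbp //; try lia.
  by rewrite mulr0 addr0.
elim: k => [|k IH]; first by rewrite big_geq // !mulr1 subr0 ev1.
rewrite big_nat_recr //= mulrA -IH !eqn mulrAC lbp_normS lbp_coef0S; ring.
Qed.

(** Both sides satisfy the first-step recursion. Here [r] is the number of up and level steps, which
    the end points determine through x + y. *)
Lemma ev_path_sum N r j k (p q : point) :
    p.2 = j%:Z -> q.2 = k%:Z -> q.1 - p.1 <= N%:Z -> q.1 + q.2 = p.1 + p.2 + 2 * r%:Z ->
  ev f (1 + r%:Z - k%:Z) (P j * P k) =
  kappa * (\prod_(1 <= i < k.+1) b i) * path_sum b c N p q.
Proof.
move=> + hq; elim: N r j p => [|N IH] r j p hp hN hr.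
  rewrite path_sum0 hp andbT; have [hpq|hpq] := eqVneq p q.
    have -> : r = 0%N by rewrite -hpq in hr; lia.
    have -> : j = k by rewrite -hpq hp in hq; lia.
    by rewrite addr0 ev_lbp_sq mulr1.
  (* The end differs from [p] and is not to its right, so [j + r < k] and orthogonality of [P k]
     gives zero. *)
  have hne : j <> k \/ (0 < r)%N.
    case: r hr => [|r] hr; [left=> hjk | by right].
    by case/eqP: hpq; apply: point_eq; lia.
  rewrite mulr0 mulrC (@lbp_orthogonal_mul _ _ _ j.+1) ?size_lbp //; lia.
have hp0 : 0 <= p.2 by rewrite hp.
(* At height 0 both sides vanish, since a down step would leave the half-plane. *)
have down : (if j is i.+1 then b j * ev f (1 + r%:Z - k%:Z) (P i * P k) else 0) =
    kappa * (\prod_(1 <= i < k.+1) b i) * (label b c p Down * path_sum b c N (move p Down) q).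
  rewrite /label hp; case: j hp => [|j] hp.
    by rewrite path_sum_neg ?mulr0 //=; lia.
  by rewrite (IH r j (move p Down)) /=; [ring|lia|lia|lia].
rewrite path_sumS // sum_step [label b c p Up]/= [label b c p Level]/= mul1r hp absz_nat.
have distr (h x u v w y : K) : h * (x + (u + y * v + w)) = h * x + (h * u + y * (h * v) + h * w).
  by ring.
(* For [r = 0] only down steps remain: the value is zero if [j < k], descends if [j > k], and is
   [ev_lbp_sq] if [j = k]. *)
rewrite distr -down; case: r hr {down} => [|r] hr.
  rewrite [X in _ + (_ * X + _ + _)]path_sum_back /=; last by lia.
  rewrite [X in _ + (_ + _ * (_ * X) + _)]path_sum_back /=; last by lia.
  rewrite !mulr0 !add0r addr0; have [hjk|hjk|hjk] := ltngtP j k.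
  - have -> : (p == q) = false by apply/eqP => hpq; rewrite -hpq hp in hq; lia.
    rewrite mulr0 add0r mulrC (@lbp_orthogonal_mul _ _ _ j.+1) ?size_lbp //; try lia.
    case: j hjk {hp hr distr} => // j hjk.
    by rewrite [P j * _]mulrC (@lbp_orthogonal_mul _ _ _ j.+1) ?mulr0 ?size_lbp //; lia.
  - have -> : (p == q) = false by apply/eqP => hpq; rewrite -hpq hp in hq; lia.
    rewrite mulr0 add0r addrC ev_lbp_rec.
    rewrite (@lbp_orthogonal_mul _ _ _ k.+1) ?size_lbp //; try lia.
    rewrite (@lbp_orthogonal_mul _ _ _ k.+1) ?size_lbp //; try lia.
    by rewrite mulr0 !add0r.
  have -> : p = q by apply: point_eq; lia.
  rewrite eqxx mulr1 hjk ev_lbp_sq; case: k {IH hjk hq} => [|k]; rewrite ?addr0 //.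
  rewrite [P k * _]mulrC (@lbp_orthogonal_mul _ _ _ k.+1) ?size_lbp //; try lia.
  by rewrite mulr0 addr0.
have -> : (p == q) = false by apply/eqP => hpq; rewrite hpq in hr; lia.
rewrite mulr0 add0r (_ : 1 + r.+1%:Z - k%:Z = 1 + r%:Z - k%:Z + 1); last by lia.
rewrite ev_lbp_rec (IH r j.+1 (move p Up)) /=; try lia.
by rewrite (IH r j (move p Level)) /=; try lia.
Qed.
End Orthogonality.

(** * Moment determinants *)

(** Sending 0 to the last place and reversing the rest adds [n] inversions. *)
Lemma rev_perm_parity n : exists s : 'S_n,
  (forall i, s i = rev_ord i) /\ odd_perm s = odd ((n * (n - 1)) %/ 2).
Proof.
elim: n => [|n [s [hs ho]]].
  by exists 1%g; split; [case | rewrite odd_perm1].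
exists (lift_perm ord0 ord_max s); split => [i|].
  case: (unliftP ord0 i) => [j ->|->]; apply: val_inj.
    rewrite lift_perm_lift hs /= /bump leq0n.
    by have := ltn_ord j; case: leqP => /=; lia.
  by rewrite lift_perm_id /= subn1.
have -> : (n.+1 * (n.+1 - 1) = n * 2 + n * (n - 1))%N by case: n {s hs ho} => // n; rewrite !subn1 /=; ring.
by rewrite divnMDl // oddD odd_lift_perm ho.
Qed.

Section MomentDet.
Variables (K : fieldType).
Implicit Types (b c : nat -> K) (f : int -> K).

Lemma moment_det_hankel f s n : moment_det f s n =
  (-1) ^+ ((n * (n - 1)) %/ 2) * \det (\matrix_(j < n, k < n) f (s - n%:Z + 1 + j%:Z + k%:Z)).
Proof.
have [u [hu ho]] := rev_perm_parity n.
rewrite -[RHS]mulr1 -signr_odd -ho -det_perm mulr1 -det_mulmx -row_permE.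
congr (\det _); apply/matrixP => j k; rewrite !mxE hu; congr (f _).
by rewrite /=; have := ltn_ord j; lia.
Qed.

(** The monic [lbp] arise from the powers of z by a unitriangular matrix, applied to rows and
    columns. *)
Lemma det_hankel_lbp b c f a n :
  \det (\matrix_(j < n, k < n) f (a + j%:Z + k%:Z)) =
  \det (\matrix_(j < n, k < n) ev f a (lbp b c j * lbp b c k)).
Proof.
pose U := \matrix_(j < n, i < n) (lbp b c j)`_i.
have hU : \det U = 1.
  rewrite det_trig; first by apply: big1 => i _; rewrite mxE; case: (size_lbp_lead b c i).
  apply/is_trig_mxP => i j hij; rewrite mxE nth_default //.
  by case: (size_lbp_lead b c i) => h _; apply: leq_trans h hij.
have -> : \matrix_(j < n, k < n) ev f a (lbp b c j * lbp b c k) =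
    U *m (\matrix_(j < n, k < n) f (a + j%:Z + k%:Z)) *m U^T.
  have hs (j : 'I_n) : (size (lbp b c j) <= n)%N.
    by case: (size_lbp_lead b c j) => h _; apply: leq_trans h (ltn_ord j).
  apply/matrixP => j k; rewrite !mxE (evM _ _ _ (hs k)); apply: eq_bigr => l _.
  rewrite !mxE mulrC (evE _ _ (hs j)); congr (_ * _); apply: eq_bigr => i _.
  by rewrite !mxE; congr (_ * f _); lia.
by rewrite !det_mulmx det_tr hU mulr1 mul1r.
Qed.

(** The factor b_j occurs for k = j, ..., n - 1. *)
Lemma prod_prod_nat (b : nat -> K) n :
  \prod_(k < n) \prod_(1 <= i < k.+1) b i = \prod_(1 <= j < n) b j ^+ (n - j).
Proof.
elim: n => [|n IH]; first by rewrite big_ord0 big_geq.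
rewrite big_ord_recr IH /=; case: n {IH} => [|n]; first by rewrite !big_geq ?mulr1.
rewrite [RHS]big_nat_recr //= subSnn expr1 [X in _ * X]big_nat_recr //= mulrA -big_split.
congr (_ * _); apply: eq_big_nat => i /andP[_ hi] /=.
by rewrite -exprSr (subSn (ltnW hi)).
Qed.

Lemma moment_det_schroder b c f kappa m n : lbp_orthogonal b c f -> f 1 = kappa ->
  moment_det f (m%:Z + n%:Z) n =
  (-1) ^+ ((n * (n - 1)) %/ 2) * kappa ^+ n * (\prod_(1 <= j < n) b j ^+ (n - j))
  * \sum_(P in schroder_tuples m n) tuple_weight b c P.
Proof.
move=> orth f1; rewrite moment_det_hankel -!mulrA; congr (_ * _).
rewrite (det_hankel_lbp b c).
(* The factor in front of the path sum depends on the column only. *)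
pose d : 'rV[K]_n := \row_k (kappa * \prod_(1 <= i < k.+1) b i).
pose N := (2 * (m + n))%N.
have -> : \matrix_(j < n, k < n) ev f (m%:Z + n%:Z - n%:Z + 1) (lbp b c j * lbp b c k) =
    (\matrix_(j < n, k < n) path_sum b c N (start_point j) (end_point m k)) *m diag_mx d.
  apply/matrixP => j k; rewrite mul_mx_diag !mxE [RHS]mulrC.
  (* From start to end x + y grows from 0 to 2(m + k), so [r] is [m + k] and the exponent is m + 1
     in every column. *)
  rewrite -(@ev_path_sum _ _ _ _ _ orth f1 _ (m + k) j k) /=; first by congr ev; lia.
  - by [].
  - by [].
  - by have := ltn_ord j; have := ltn_ord k; rewrite /N; lia.
  - lia.
rewrite det_mulmx det_diag (eq_bigr (fun k : 'I_n => kappa * \prod_(1 <= i < k.+1) b i)) => [|k _];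
  last by rewrite mxE.
rewrite big_split /= prodr_const card_ord prod_prod_nat mulrC -mulrA; congr (_ * (_ * _)).
rewrite (@det_nonintersecting _ b c _ _
  (fun j : 'I_n => start_point j) (fun k : 'I_n => end_point m k)).
- by apply: eq_bigl => P; rewrite inE.
- by move=> i j; rewrite /N /=; have := ltn_ord i; have := ltn_ord j; lia.
- by move=> i; exists 0; rewrite /=; lia.
- by move=> i j hij; apply/andP; split; rewrite /=; lia.
by move=> i j hij; apply/andP; split; rewrite /=; lia.
Qed.

(** * Inversion of the variable *)

Section Inversion.
Variables (b c : nat -> K) (f : int -> K).
Hypothesis hc : forall n, c n != 0.
Let b' i := b i / (c i.-1 * c i).
Let c' i := (c i)^-1.

Lemma lbp_coef0_neq0 n : (lbp b c n)`_0 != 0.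
Proof.
elim: n => [|n IH]; first by rewrite coef1 oner_eq0.
by rewrite lbp_coef0S mulf_neq0 // oppr_eq0.
Qed.

(* Up to the factor 1 / P_n(0), the polynomial attached to b' and c' is z^n P_n(1/z). *)
Lemma ev_lbp_inv n a : ev (fun k => f (1 - k)) a (lbp b' c' n) =
  ev f (1 - a - n%:Z) (lbp b c n) / (lbp b c n)`_0.
Proof.
suff: (forall a, ev (fun k => f (1 - k)) a (lbp b' c' n) =
    ev f (1 - a - n%:Z) (lbp b c n) / (lbp b c n)`_0) /\
  (forall a, ev (fun k => f (1 - k)) a (lbp b' c' n.+1) =
    ev f (1 - a - n.+1%:Z) (lbp b c n.+1) / (lbp b c n.+1)`_0) by case.
have recE (b0 c0 : nat -> K) g d j : ev g d (lbp b0 c0 j.+1) = ev g (d + 1) (lbp b0 c0 j)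
    - c0 j * ev g d (lbp b0 c0 j)
    - (if j is i.+1 then b0 j * ev g (d + 1) (lbp b0 c0 i) else 0).
  have := ev_lbp_rec b0 c0 g d j 1; rewrite mulr1 => ->.
  by case: j => [|j]; rewrite !mulr1; ring.
elim: n {a} => [|n [IH0 IH1]].
  have H0 d : ev (fun k => f (1 - k)) d (lbp b' c' 0) =
      ev f (1 - d - 0%:Z) (lbp b c 0) / (lbp b c 0)`_0.
    by rewrite !ev1 coef1 divr1 subr0.
  split=> // d; rewrite !recE !H0 lbp_coef0S coef1 !subr0 /c' mulr1.
  rewrite (_ : 1 - d - 1 + 1 = 1 - d); last by lia.
  rewrite (_ : 1 - (d + 1) = 1 - d - 1%N%:Z); last by lia.
  by rewrite eqxx !divr1; field; rewrite oppr_eq0 hc.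
split=> // d; rewrite recE !IH1 IH0 [ev f _ (lbp b c n.+2)]recE.
rewrite !lbp_coef0S.
rewrite (_ : 1 - d - n.+2%:Z + 1 = 1 - d - n.+1%:Z); last by lia.
rewrite (_ : 1 - (d + 1) - n.+1%:Z = 1 - d - n.+2%:Z); last by lia.
rewrite (_ : 1 - (d + 1) - n%:Z = 1 - d - n.+1%:Z); last by lia.
rewrite /b' /c' /=; field.
by rewrite lbp_coef0_neq0 !oppr_eq0 !hc.
Qed.

(** Inversion reverses the range of orthogonality: the exponent -k becomes -(n - 1 - k). *)
Lemma lbp_orthogonal_inv : lbp_orthogonal b c f ->
  lbp_orthogonal b' c' (fun k => f (1 - k)).
Proof.
move=> orth n k hk; rewrite ev_lbp_inv.
rewrite (_ : 1 - - k%:Z - n%:Z = - (n - k.+1)%N%:Z); last by lia.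
by rewrite orth ?mul0r //; lia.
Qed.
End Inversion.

(** Inversion changes the sign of k - j, which transposition undoes. *)
Lemma moment_det_inv f s n : moment_det f s n = moment_det (fun k => f (1 - k)) (1 - s) n.
Proof.
rewrite /moment_det -det_tr; congr (\det _); apply/matrixP => j k.
by rewrite !mxE; congr f; lia.
Qed.

Lemma orthogonal_moment b c (L : {linear laurent K -> K^o}) :
  biorthogonal b c L -> lbp_orthogonal b c (moment L).
Proof.
case=> h _ hL n k hk; have := hL n k (ltnW hk); rewrite gtn_eqF // => <-.
by rewrite /poly_zpow linear_sum; apply: eq_bigr => i _; rewrite linearZ.
Qed.
End MomentDet.

Theorem theorem6 (K : fieldType) (b c : nat -> K) (kappa : K)
  (hb : forall n : nat, (1 <= n)%N -> b n != 0)
  (hc : forall n : nat, c n != 0)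
  (hkappa : kappa != 0)
  (L : {linear laurent K -> K^o})
  (hL : biorthogonal b c L)
  (hL1 : moment L 1 = kappa)
  (s : int) (n : nat) :
  let kappa' : K := kappa / c 0%N in
  let b' : nat -> K := fun i => b i / (c i.-1 * c i) in
  let c' : nat -> K := fun i => (c i)^-1 in
  (n%:Z <= s ->
     moment_det (moment L) s n =
       (-1) ^+ ((n * (n - 1)) %/ 2)%N * kappa ^+ n
       * (\prod_(1 <= j < n) b j ^+ (n - j)%N)
       * \sum_(P in schroder_tuples (absz (s - n%:Z)%R) n) tuple_weight b c P)
  /\
  (s <= - n%:Z + 1 ->
     moment_det (moment L) s n =
       (-1) ^+ ((n * (n - 1)) %/ 2)%N * kappa' ^+ n
       * (\prod_(1 <= j < n) b' j ^+ (n - j)%N)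
       * \sum_(P in schroder_tuples (absz (`|s| - n%:Z + 1)%R) n)
           tuple_weight b' c' P).
Proof.
move=> kappa' b' c'; have orth := orthogonal_moment hL.
split=> hs.
  by rewrite -(moment_det_schroder _ _ orth hL1); congr moment_det; lia.
(* The inverted functional has first moment f_0, and F[z - c_0] = 0 gives f_0 = kappa / c_0. *)
have f0 : moment L (1 - 1) = kappa'.
  have h0 := orth 1%N 0%N isT; rewrite oppr0 in h0.
  have := ev_lbp_rec b c (moment L) 0 0 1; rewrite !mulr1 h0 !ev1 hL1 add0r addr0 /kappa' => ->.
  by rewrite mulrC mulKf.
rewrite -(moment_det_schroder _ _ (lbp_orthogonal_inv hc orth) f0) moment_det_inv.
(* For [n = 0] the value [s = 1] is allowed and the indices disagree, but both determinants are
   empty; otherwise [s <= 0]. *)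
case: n hs => [|n] hs; first by rewrite /moment_det !det_mx00.
by congr moment_det; lia.
Qed.
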